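(* Let $P\in\mathbb{C}[z]$ be a balanced polynomial with $|P(0)|=1$, $\|P\|_0<e$, and $Z(P)\geq 1$. Then \[ \frac{\log^2 M(P)}{Z(P)} \geq \log\|P\|_0, \] where $\log^2 M(P)=(\log M(P))^2$.
   Context: For a nonzero polynomial $P\in\mathbb{C}[z]$, the (logarithmic) Mahler measure is $\log M(P)=\frac{1}{2\pi}\int_0^{2\pi}\log|P(e^{it})|\,dt$, and the areal Mahler measure is defined by $\log\|P\|_0=\frac{1}{\pi}\iint_{D}\log|P(z)|\,dA$, where $D$ is the open unit disk in $\mathbb{C}$ and $dA$ is area measure. $Z(P)$ denotes the number of roots of $P$ (counted with multiplicity) lying in the open unit disk. $P$ is called balanced if all roots of $P$ lying in the open unit disk have the same absolute value. *)

(* Defs.v *)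
From HB Require Import structures.
From mathcomp Require Import all_boot all_order all_algebra.
From mathcomp Require Import complex.
From mathcomp Require Import all_classical all_reals all_analysis.

Set Implicit Arguments.
Unset Strict Implicit.
Unset Printing Implicit Defensive.

Import Order.TTheory GRing.Theory Num.Theory.

Local Open Scope classical_set_scope.
Local Open Scope ring_scope.

(* The modulus, valued in R; the generic norm `|z| has values in R[i]. *)
Notation modulus := complex.ComplexField.Normc.normc.

Section MahlerMeasures.
Variable R : realType.
Implicit Types P : {poly R[i]}.

(* Since ln 0 = 0, the integrands below are real-valued everywhere; they differ
   from log |P| only at the zeros of P, which form a null set when P != 0. *)
Definition log_mahler P : R :=
  (2 * pi)^-1 * \int[lebesgue_measure]_(t in `[0, 2 * pi])
                  ln (modulus P.[Complex (cos t) (sin t)]).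

Definition mahler P : R := expR (log_mahler P).

Definition unit_disk : set (R * R) :=
  [set xy | modulus (Complex xy.1 xy.2) < 1].

Definition log_areal_mahler P : R :=
  pi^-1 * \int[(lebesgue_measure \x lebesgue_measure)%E]_(xy in unit_disk)
            ln (modulus P.[Complex xy.1 xy.2]).

Definition areal_mahler P : R := expR (log_areal_mahler P).

(* The roots of P, each repeated according to its multiplicity; meaningful only
   for P != 0. *)
Definition roots_with_mult P : seq R[i] := sval (closed_field_poly_normal P).

Definition num_roots_disk P : nat :=
  count (fun z => modulus z < 1) (roots_with_mult P).

Definition balanced P : Prop :=
  forall z w : R[i], root P z -> root P w ->
    modulus z < 1 -> modulus w < 1 -> modulus z = modulus w.

End MahlerMeasures.

(* Main.v *)
(* If c is the leading coefficient and z_1, ..., z_n are the roots of P, then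
   Jensen's formula gives log M(P) = ln |c| + sum_i ln max(1, |z_i|), and the
   mean of ln |z - a| over the unit disk is ln |a| for |a| >= 1 and
   (|a|^2 - 1) / 2 for |a| < 1. As |c| |z_1| ... |z_n| = |P(0)| = 1, for roots
   of common modulus rho in the disk and L = - ln rho one gets
     log M(P) = Z L  and  log ||P||_0 = Z (L - (1 - exp (- 2 L)) / 2),
   and the theorem is exp (- x) <= 1 - x + x^2 / 2 at x = 2 L.

   Jensen's formula J(z) = 2 pi ln max(1, |z|) for the integral J(z) of
   ln |e^(it) - z| follows for |z| < 1 from J(z^2) = 2 J(z) and boundedness; for
   |z| = 1 only integrability and J(z) >= 0 are needed, which Fatou's lemma
   gives. For the area integral, rotation invariance of the plane Lebesgue
   measure (a rotation is a product of shears) and Tonelli's theorem replace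
   ln |z - a| by its mean ln max(|z|, |a|) over rotations, which is radial. *)

Require Import Defs.
From HB Require Import structures.
From mathcomp Require Import all_boot all_order all_algebra.
From mathcomp Require Import complex.
From mathcomp Require Import all_classical all_reals all_analysis.
From mathcomp Require Import measurable_realfun ring lra.

Set Implicit Arguments.
Unset Strict Implicit.
Unset Printing Implicit Defensive.

Import Order.TTheory GRing.Theory Num.Theory.
Import numFieldNormedType.Exports.

Local Open Scope classical_set_scope.
Local Open Scope ring_scope.

(** * Modulus and Jensen's formula off the unit circle *)

Section Modulus.
Context {R : realType}.
Implicit Types (z w : R[i]) (x y t : R).

Lemma modulus_ge0 z : 0 <= modulus z.
Proof. by case: z => x y; exact: sqrtr_ge0. Qed.

Lemma modulus_eq0 z : (modulus z == 0) = (z == 0).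
Proof.
apply/eqP/eqP => [/Normc.eq0_normc //|->]; exact: Normc.normc0.
Qed.

Lemma modulus_gt0 z : (0 < modulus z) = (z != 0).
Proof. by rewrite lt_def modulus_ge0 andbT modulus_eq0. Qed.

Lemma modulusN z : modulus (- z) = modulus z.
Proof. exact: normcN. Qed.

Lemma modulusD_le z w : modulus (z + w) <= modulus z + modulus w.
Proof. exact: le_normcD. Qed.

Lemma modulusB_le z w : modulus (z - w) <= modulus z + modulus w.
Proof. by rewrite -(modulusN w); exact: modulusD_le. Qed.

Lemma modulusB_ge z w : modulus z - modulus w <= modulus (z - w).
Proof. by rewrite lerBlDr -{1}(subrK w z); exact: modulusD_le. Qed.

Lemma modulusX z n : modulus (z ^+ n) = modulus z ^+ n.
Proof.
elim: n => [|n IH]; first by rewrite !expr0; exact: Normc.normc1.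
by rewrite !exprS Normc.normcM IH.
Qed.

Lemma modulusJ z : modulus (conjc z) = modulus z.
Proof. by case: z => x y /=; rewrite sqrrN. Qed.

Lemma modulus_prod (I : Type) (s : seq I) (f : I -> R[i]) :
  modulus (\prod_(i <- s) f i) = \prod_(i <- s) modulus (f i).
Proof.
elim: s => [|i s IH]; first by rewrite !big_nil; exact: Normc.normc1.
by rewrite !big_cons Normc.normcM IH.
Qed.

Definition cis t : R[i] := Complex (cos t) (sin t).

Lemma modulus_cis t : modulus (cis t) = 1.
Proof. by rewrite /= cos2Dsin2 sqrtr1. Qed.

Lemma cisDpi t : cis (t + pi) = - cis t.
Proof. by rewrite /cis cosDpi sinDpi; apply/eqP; rewrite eq_complex /= !eqxx. Qed.

Lemma cis_double t : cis (2 * t) = cis t ^+ 2.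
Proof.
apply/eqP; rewrite mulr_natl /cis cos_mulr2n sin_mulr2n expr2 eq_complex /=.
apply/andP; split; apply/eqP; last by rewrite mulr2n; ring.
by have := cos2Dsin2 t; rewrite mulr2n; nra.
Qed.

Lemma conj_cis_mul t : conjc (cis t) * cis t = 1.
Proof.
apply/eqP; rewrite eq_complex /=; have := cos2Dsin2 t => h.
by apply/andP; split; apply/eqP; [rewrite -h|]; ring.
Qed.

Lemma modulus_cisB_gt0 t z : modulus z != 1 -> 0 < modulus (cis t - z).
Proof.
by rewrite modulus_gt0 subr_eq0; apply: contra => /eqP <-; rewrite modulus_cis.
Qed.

Lemma modulus_cisB_ge t z : 1 - modulus z <= modulus (cis t - z).
Proof. by rewrite -{1}(modulus_cis t); exact: modulusB_ge. Qed.

Lemma modulus_cisB_le t z : modulus (cis t - z) <= 1 + modulus z.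
Proof. by rewrite -{1}(modulus_cis t); exact: modulusB_le. Qed.

Lemma continuous_modulus_cisB z : continuous (fun t => modulus (cis t - z)).
Proof.
move=> t; case: z => a b /=.
apply: (@continuous_comp R R R (fun t => (cos t - a) ^+ 2 + (sin t - b) ^+ 2)
  Num.sqrt); last exact: sqrt_continuous.
apply: cvgD.
  apply: (cvg_comp (fun t : R => cos t - a) (fun x => x ^+ 2)).
    by apply: cvgB; [exact: continuous_cos|exact: cvg_cst].
  exact: exprn_continuous.
apply: (cvg_comp (fun t : R => sin t - b) (fun x => x ^+ 2)).
  by apply: cvgB; [exact: continuous_sin|exact: cvg_cst].
exact: exprn_continuous.
Qed.

End Modulus.

(** * The integral of ln |e^(it) - z| over the circle for |z| != 1 *)

Section Jensen.
Context {R : realType}.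
Local Notation mu := (@lebesgue_measure R).
Implicit Types (a b c d t : R) (z w : R[i]).

Definition lncis z t := ln (modulus (cis t - z)).

Lemma continuous_lncis z : modulus z != 1 -> continuous (lncis z).
Proof.
move=> z1 t; apply: continuous_comp; first exact: continuous_modulus_cisB.
by apply: continuous_ln; exact: modulus_cisB_gt0.
Qed.

Lemma measurable_lncis z : measurable_fun setT (lncis z).
Proof.
apply: measurableT_comp => //; apply: continuous_measurable_fun.
exact: continuous_modulus_cisB.
Qed.

Lemma continuous_integrable_itv (f : R -> R) a b : continuous f ->
  mu.-integrable `[a, b] (EFin \o f).
Proof.
move=> cf; apply: continuous_compact_integrable; first exact: segment_compact.
exact: continuous_subspaceT.
Qed.

(** Linear substitution, needed for the doubling [t -> 2 * t] and the half-turn [t -> t + pi] behind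
    the functional equation of [int_lncis]. *)
Lemma Rintegral_affine (f : R -> R) a b c d : continuous f -> a <= b -> 0 < c ->
  \int[mu]_(x in `[c * a + d, c * b + d]) f x =
  c * \int[mu]_(x in `[a, b]) f (c * x + d).
Proof.
move=> cf ab c0; pose F x := c * x + d.
have dF (x : R) : is_derive x (1 : R) F c.
  by apply: is_derive_eq; rewrite /GRing.scale /= mulr1 ?scaler0 ?addr0 ?add0r.
have F'E : (F^`())%classic = cst c.
  by apply/funext => x; rewrite derive1E derive_val.
have cF : continuous F.
  by move=> x; apply: differentiable_continuous; apply/derivable1_diffP.
rewrite -RintegralZl//; last first.
  apply: (@continuous_integrable_itv (f \o F)) => x.
  by apply: continuous_comp; [exact: cF|exact: cf].
rewrite /Rintegral; congr fine.
rewrite (@integration_by_substitution_increasing R F f a b) //=.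
- by apply: eq_integral => x _; rewrite F'E fctE /= mulrC.
- by move=> x y _ _ xy; rewrite /F ltrD2r ltr_pM2l.
- by move=> x _; rewrite F'E; exact: cst_continuous.
- by rewrite F'E; exact: is_cvg_cst.
- by rewrite F'E; exact: is_cvg_cst.
- split=> [x _||]; first by case: (dF x).
  + by apply: cvg_at_right_filter; exact: cF.
  + by apply: cvg_at_left_filter; exact: cF.
- exact: continuous_subspaceT.
Qed.

Lemma Rintegral_itv_split (f : R -> R) a b c : continuous f -> a <= b <= c ->
  \int[mu]_(x in `[a, c]) f x =
  \int[mu]_(x in `[a, b]) f x + \int[mu]_(x in `[b, c]) f x.
Proof.
move=> cf /andP[ab bc].
have := @Rintegral_itvB R f (BLeft a) (BRight c) b
  (@continuous_integrable_itv f a c cf).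
rewrite !bnd_simp => /(_ ab bc) h.
rewrite -(Rintegral_itv_obnd_cbnd (r := b)).
  by rewrite -h addrC subrK.
apply: integrableS (@continuous_integrable_itv f b c cf) => //.
exact: subset_itv_oc_cc.
Qed.

Lemma Rintegral_cst_circle c : \int[mu]_(t in `[0, 2 * pi]) c = 2 * pi * c.
Proof.
rewrite Rintegral_cst // mulrC; congr (_ * _).
have /= -> := @lebesgue_measure_itv R `[0, 2 * pi]%R.
by rewrite lte_fin mulr_gt0 ?pi_gt0 // sube0.
Qed.

Definition int_lncis z := \int[mu]_(t in `[0, 2 * pi]) lncis z t.

(* The two square roots of [z ^+ 2] give
   ln |cis (2 t) - z ^+ 2| = ln |cis t - z| + ln |cis (t + pi) - z|. *)
Lemma jensen_square z : modulus z < 1 -> int_lncis (z ^+ 2) = 2 * int_lncis z.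
Proof.
move=> z1; have zn1 : modulus z != 1 by rewrite lt_eqF.
have z2n1 : modulus (z ^+ 2) != 1.
  by rewrite modulusX lt_eqF // exprn_ilt1 // modulus_ge0.
have pi0 : 0 <= pi :> R := pi_ge0 R.
have e0 : 2 * 0 + 0 = 0 :> R by ring.
have e1 : 2 * pi + 0 = 2 * pi :> R by ring.
have e2 : 1 * 0 + pi = pi :> R by ring.
have e3 : 1 * pi + pi = 2 * pi :> R by ring.
rewrite /int_lncis.
(* Doubling carries [[0, pi]] onto the whole circle on the left side; on the right side the circle
   is cut at [pi] and its second half is shifted back to [[0, pi]]. *)
have := @Rintegral_affine (lncis (z ^+ 2)) 0 pi 2 0 (continuous_lncis z2n1) pi0.
rewrite e0 e1 => ->//; congr (_ * _).
rewrite (@Rintegral_itv_split (lncis z) 0 pi); first last.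
- by rewrite pi0 /= ler_peMl // ler1n.
- exact: continuous_lncis.
have := @Rintegral_affine (lncis z) 0 pi 1 pi (continuous_lncis zn1) pi0.
rewrite e2 e3 => ->//; rewrite mul1r -RintegralD //.
- apply: eq_Rintegral => t _; rewrite addr0 mul1r /lncis cis_double cisDpi.
  rewrite subr_sqr Normc.normcM lnM ?posrE ?modulus_cisB_gt0//.
  + by congr (_ + ln _); rewrite -modulusN opprD.
  + by rewrite -(opprK z) modulus_cisB_gt0 // modulusN.
- exact/continuous_integrable_itv/continuous_lncis.
- apply: (@continuous_integrable_itv (fun t => lncis z (1 * t + pi))) => t.
  apply: (@continuous_comp R R R (fun t => 1 * t + pi)).
    apply: cvgD; last exact: cvg_cst.
    by apply: cvgM; [exact: cvg_cst|exact: cvg_id].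
  exact: continuous_lncis.
Qed.

(** On the circle, 1 - |z| <= |cis t - w| <= 2. The bound does not depend on [w], so it serves all
    powers of [z] at once. *)
Lemma jensen_lt1_bound z w : modulus z < 1 -> modulus w <= modulus z ->
  `|int_lncis w| <= 2 * pi * (ln 2 - ln (1 - modulus z)).
Proof.
move=> z1 wz; have w1 : modulus w < 1 := le_lt_trans wz z1.
have wn1 : modulus w != 1 by rewrite lt_eqF.
apply: le_trans (le_normr_Rintegral _ _) _ => //.
  exact/continuous_integrable_itv/continuous_lncis.
have -> : 2 * pi * (ln 2 - ln (1 - modulus z)) =
  \int[mu]_(t in `[0, 2 * pi]) (ln 2 - ln (1 - modulus z)).
  by rewrite Rintegral_cst_circle.
apply: le_Rintegral => //.
- apply: (@continuous_integrable_itv (fun t => `|lncis w t|)) => t.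
  by apply: continuous_comp; [exact: continuous_lncis|exact: norm_continuous].
- by apply: (@continuous_integrable_itv (cst _)) => t; exact: cst_continuous.
- move=> t _; rewrite ler_norml; have z0 := modulus_ge0 z.
  have hb : ln (1 - modulus z) <= lncis w t.
    rewrite ler_ln ?posrE ?subr_gt0 ?modulus_cisB_gt0 //.
    by apply: le_trans (modulus_cisB_ge _ _); rewrite lerD2l lerN2.
  have ha : lncis w t <= ln 2.
    rewrite ler_ln ?posrE ?modulus_cisB_gt0 //.
    by apply: le_trans (modulus_cisB_le _ _) _; lra.
  have h2 : 0 <= ln 2 :> R by rewrite ln_ge0 // ler1n.
  have h3 : ln (1 - modulus z) <= 0 by rewrite ln_le0 // gerBl.
  by apply/andP; split; lra.
Qed.

Lemma jensen_iter z n : modulus z < 1 ->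
  int_lncis (z ^+ (2 ^ n)) = 2 ^+ n * int_lncis z.
Proof.
move=> z1; elim: n => [|n IH]; first by rewrite expr0 mul1r expn0 expr1.
rewrite expnSr exprM jensen_square ?IH ?exprS ?mulrA//.
by rewrite modulusX exprn_ilt1 ?modulus_ge0 // expn_eq0.
Qed.

(** By [jensen_iter] a nonzero value would make [int_lncis (z ^+ (2 ^ n))] grow like 2^n, against
    the uniform bound [K]. *)
Lemma jensen_lt1 z : modulus z < 1 -> int_lncis z = 0.
Proof.
move=> z1; apply/eqP; rewrite -normr_eq0; apply/negP => /negP.
rewrite -normr_gt0 normr_id => Jz.
set K := 2 * pi * (ln 2 - ln (1 - modulus z)).
have h n : n%:R * `|int_lncis z| <= K.
  apply: (@le_trans _ _ (2 ^+ n * `|int_lncis z|)).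
    by rewrite ler_pM2r // -natrX ler_nat ltnW // ltn_expl.
  have -> : 2 ^+ n * `|int_lncis z| = `|int_lncis (z ^+ (2 ^ n))|.
    by rewrite jensen_iter // normrM (ger0_norm (exprn_ge0 _ _)).
  apply: jensen_lt1_bound => //.
  rewrite modulusX ler_iXnr ?modulus_ge0 ?expn_gt0 //.
  exact: ltW.
have := h (Num.truncn (K / `|int_lncis z|)).+1; rewrite leNgt => /negP; apply.
by rewrite -ltr_pdivrMr // truncnS_gt.
Qed.

(** Reflection in the unit circle: with [w] the conjugate of 1/z, |cis t - z| = |z| |cis t - w| and
    |w| < 1. *)
Lemma jensen_gt1 z : 1 < modulus z -> int_lncis z = 2 * pi * ln (modulus z).
Proof.
move=> z1; have z0 : z != 0 by rewrite -modulus_gt0; exact: lt_trans z1.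
pose w := conjc z^-1.
have w1 : modulus w < 1 by rewrite modulusJ Normc.normcV invf_lt1 ?modulus_gt0.
have wn1 : modulus w != 1 by rewrite lt_eqF.
have E t : lncis z t = ln (modulus z) + lncis w t.
  rewrite /lncis -lnM ?posrE ?modulus_gt0 ?modulus_cisB_gt0//; last first.
    by rewrite -modulus_gt0 modulus_cisB_gt0.
  congr ln; rewrite -[modulus (cis t - w)]modulusJ -[LHS]mul1r.
  rewrite -(modulus_cis t) -(modulusJ (cis t)) -!Normc.normcM mulrBr conj_cis_mul.
  rewrite rmorphB /= /w conjcK mulrBr divff // -[LHS]modulusN opprB.
  by rewrite (mulrC z).
transitivity (\int[mu]_(t in `[0, 2 * pi]) (ln (modulus z) + lncis w t)).
  by apply: eq_Rintegral => t _.
rewrite RintegralD //.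
- by rewrite -/(int_lncis w) jensen_lt1 // addr0 Rintegral_cst_circle.
- by apply: (@continuous_integrable_itv (cst _)) => t; exact: cst_continuous.
- exact/continuous_integrable_itv/continuous_lncis.
Qed.

Lemma jensen z : modulus z != 1 ->
  int_lncis z = 2 * pi * ln (Num.max 1 (modulus z)).
Proof.
move=> z1; case: (ltgtP (modulus z) 1) z1 => // h _.
- by rewrite jensen_lt1 // ln1 mulr0.
- by rewrite jensen_gt1.
Qed.

End Jensen.

(** * Jensen's formula on the unit circle *)

Section JensenUnit.
Context {R : realType}.
Local Notation mu := (@lebesgue_measure R).
Implicit Types (t s : R) (z : R[i]).

Lemma limn_einf_ge (u : (\bar R)^nat) (c : \bar R) :
  (forall n, (c <= u n)%E) -> (c <= limn_einf u)%E.
Proof.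
move=> cu; rewrite limn_einf_lim; apply: lime_ge; first exact: is_cvg_einfs.
by apply: nearW => n; apply/ereal_infP => _ [m _ <-].
Qed.

Lemma continuous_modulus_scale t z :
  continuous (fun s : R => modulus (cis t - s%:C%C * z)).
Proof.
move=> s; case: z => a b /=.
apply: (@continuous_comp R R R (fun s => (cos t - (s * a - 0 * b)) ^+ 2
  + (sin t - (s * b + 0 * a)) ^+ 2) Num.sqrt); last exact: sqrt_continuous.
have cM c : (fun s : R => s * c) @ s --> s * c.
  by apply: cvgM; [exact: cvg_id|exact: cvg_cst].
apply: cvgD.
  apply: (cvg_comp (fun s : R => cos t - (s * a - 0 * b)) (fun x => x ^+ 2)).
    by apply: cvgB; [exact: cvg_cst|apply: cvgB; [exact: cM|exact: cvg_cst]].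
  exact: exprn_continuous.
apply: (cvg_comp (fun s : R => sin t - (s * b + 0 * a)) (fun x => x ^+ 2)).
  by apply: cvgB; [exact: cvg_cst|apply: cvgD; [exact: cM|exact: cvg_cst]].
exact: exprn_continuous.
Qed.

Lemma modulus_scale s z : 0 <= s -> modulus (s%:C%C * z) = s * modulus z.
Proof.
by move=> s0; rewrite Normc.normcM /= expr0n /= addr0 sqrtr_sqr ger0_norm.
Qed.

Lemma sub_scale s z : z - s%:C%C * z = (1 - s)%:C%C * z.
Proof. by rewrite rmorphB rmorph1 mulrBl mul1r. Qed.

(* Fatou applied to the radial dilations [s z], s -> 1. *)
Lemma jensen_eq1_le z : modulus z = 1 ->
  (\int[mu]_(t in `[0%R, (2 * pi)%R]) (ln 2 - lncis z t)%:E <=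
   (2 * pi * ln 2)%:E)%E.
Proof.
(* These radii lie in [0, 1) and tend to 1, so each [s n * z] is inside the disk, where [jensen_lt1]
   gives the integral 0. *)
move=> z1; pose s n : R := 1 - n.+2%:R^-1.
have s01 n : 0 <= s n < 1.
  by rewrite subr_ge0 invf_le1 ?ltr0n // ler1n /= ltrBlDr ltrDl invr_gt0 ltr0n.
have s1 : s n @[n --> \oo] --> (1 : R).
  rewrite -[X in _ --> X]subr0; apply: cvgB; first exact: cvg_cst.
  have := @cvg_harmonic R; rewrite -cvg_shiftS; apply: cvg_trans.
  by apply: near_eq_cvg; near=> n.
have m1 n : modulus ((s n)%:C%C * z) < 1.
  by have /andP[s0 sn1] := s01 n; rewrite modulus_scale // z1 mulr1.
have n1 n : modulus ((s n)%:C%C * z) != 1 by rewrite lt_eqF.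
pose f n t := (ln 2 - lncis ((s n)%:C%C * z) t)%:E.
have ln_le n t : lncis ((s n)%:C%C * z) t <= ln 2.
  rewrite ler_ln ?posrE ?modulus_cisB_gt0 //.
  by apply: le_trans (modulus_cisB_le _ _) _; have := m1 n; lra.
have f0 n t : `[0, 2 * pi]%classic t -> (0 <= f n t)%E.
  by move=> _; rewrite lee_fin subr_ge0.
have mf n : measurable_fun `[0, 2 * pi] (f n).
  apply/measurable_funTS/measurable_EFinP/measurable_funB => //.
  exact: measurable_lncis.
have intf n : (\int[mu]_(t in `[0%R, (2 * pi)%R]) f n t = (2 * pi * ln 2)%:E)%E.
  have ci : mu.-integrable `[0, 2 * pi] (EFin \o lncis ((s n)%:C%C * z)).
    exact/continuous_integrable_itv/continuous_lncis.
  have cc : mu.-integrable `[0, 2 * pi] (EFin \o (fun=> ln 2 : R)).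
    by apply: (@continuous_integrable_itv R (cst _)) => t; exact: cst_continuous.
  have := RintegralB _ cc ci => /(_ (measurable_itv _)).
  rewrite -/(int_lncis _) jensen_lt1 // subr0 Rintegral_cst_circle => <-.
  rewrite /Rintegral fineK //; apply: integrable_fin_num => //.
  by have := integrableB _ cc ci => /(_ (measurable_itv _)).
have /= := fatou mu (measurable_itv _) mf f0.
under [X in (_ <= limn_einf X)%E]eq_fun do rewrite intf.
have hc : (fun=> (2 * pi * ln 2 : R)%:E) @ \oo --> (2 * pi * ln 2 : R)%:E.
  exact: cvg_cst.
have [-> _] := cvg_limn_einf_sup hc.
apply: le_trans; apply: ge0_le_integral => //=.
- move=> t _; rewrite lee_fin subr_ge0.
  have [e|e] := eqVneq (modulus (cis t - z)) 0.
    by rewrite /lncis e ln0 // ln_ge0 // ler1n.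
  rewrite ler_ln ?posrE // ?lt_def ?e ?modulus_ge0 //.
  by apply: le_trans (modulus_cisB_le _ _) _; rewrite z1.
- apply/measurable_funTS/measurable_EFinP/measurable_funB => //.
  exact: measurable_lncis.
(* Measurability of the lower limit is that of an upper limit, up to sign. *)
- have -> : (fun t => limn_einf (f ^~ t)) =
      (fun t => - limn_esup (fun n => - f n t))%E.
    apply/funext => t; rewrite -limn_einfN; congr limn_einf.
    by apply/funext => n /=; rewrite opprK.
  apply: measurableT_comp => //; apply: measurable_fun_limn_esup => n.
  by apply: measurableT_comp; [exact: oppe_measurable|exact: mf].
(* At [cis t = z] the convention ln 0 = 0 breaks pointwise convergence, but ln |cis t - s n * z| =
   ln (1 - s n) <= 0 still puts every [f n t] above [ln 2]. Elsewhere the integrands converge by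
   continuity. *)
- move=> t _; have [e|e] := eqVneq (cis t) z.
    apply: limn_einf_ge => n; rewrite /f lee_fin lerD2l lerN2.
    rewrite {2}/lncis -e subrr Normc.normc0 ln0 // ln_le0 //.
    have /andP[s0 sn1] := s01 n.
    have -> : cis t - (s n)%:C%C * cis t = (1 - s n)%:C%C * cis t.
      exact: sub_scale.
    by rewrite modulus_scale ?modulus_cis ?subr_ge0 ?(ltW sn1) // mulr1 gerBl.
  suff h : f n t @[n --> \oo] --> (ln 2 - lncis z t)%:E.
    by have [-> _] := cvg_limn_einf_sup h.
  apply: cvg_EFin; first by apply: nearW.
  apply: cvgB; first exact: cvg_cst.
  have e1 : (1 : R)%:C%C * z = z by rewrite mul1r.
  have h1 : {for 1, continuous (fun s : R => ln (modulus (cis t - s%:C%C * z)))}.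
    apply: continuous_comp; first exact: continuous_modulus_scale.
    by apply: continuous_ln; rewrite e1 modulus_gt0 subr_eq0.
  have := cvg_comp _ _ s1 h1; rewrite e1; exact.
Unshelve. all: by end_near. Qed.

(** On the unit circle [ln 2 - lncis z] is nonnegative, and Fatou's bound makes its integral
    finite. *)
Lemma integrable_lncis z : mu.-integrable `[0, 2 * pi] (EFin \o lncis z).
Proof.
have [z1|z1] := eqVneq (modulus z) 1; last first.
  exact/continuous_integrable_itv/continuous_lncis.
have cc : mu.-integrable `[0, 2 * pi] (EFin \o (fun=> ln 2 : R)).
  by apply: (@continuous_integrable_itv R (cst _)) => t; exact: cst_continuous.
have ii : mu.-integrable `[0, 2 * pi] (EFin \o (fun t => ln 2 - lncis z t)).
  apply/integrableP; split.
    apply/measurable_funTS/measurable_EFinP/measurable_funB => //.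
    exact: measurable_lncis.
  apply: le_lt_trans (ltry (2 * pi * ln 2)).
  apply: le_trans (jensen_eq1_le z1).
  rewrite le_eqVlt; apply/orP; left; apply/eqP; apply: eq_integral => t _ /=.
  rewrite ger0_norm // subr_ge0.
  have [e|e] := eqVneq (modulus (cis t - z)) 0.
    by rewrite /lncis e ln0 // ln_ge0 // ler1n.
  rewrite ler_ln ?posrE // ?lt_def ?e ?modulus_ge0 //.
  by apply: le_trans (modulus_cisB_le _ _) _; rewrite z1.
have := integrableB _ cc ii => /(_ (measurable_itv _)).
by apply: eq_integrable => // t _ /=; rewrite -EFinB opprB addrC subrK.
Qed.

(** Fatou's lemma gives one direction for |z| = 1. It is the direction that serves, since log M(P)
    has to be bounded from below. *)
Lemma jensen_ge z : 2 * pi * ln (Num.max 1 (modulus z)) <= int_lncis z.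
Proof.
have [z1|z1] := eqVneq (modulus z) 1; last by rewrite jensen.
rewrite z1 maxxx ln1 mulr0.
have cc : mu.-integrable `[0, 2 * pi] (EFin \o (fun=> ln 2 : R)).
  by apply: (@continuous_integrable_itv R (cst _)) => t; exact: cst_continuous.
have zi := integrable_lncis z.
have := jensen_eq1_le z1.
rewrite (integralB_EFin _ cc zi) //= -[X in (X - _ <= _)%E]fineK; last first.
  exact: integrable_fin_num cc.
rewrite -[X in (_ - X <= _)%E]fineK; last exact: integrable_fin_num zi.
rewrite -EFinB lee_fin.
have /= := Rintegral_cst_circle (ln 2 : R); rewrite /Rintegral => ->.
by rewrite gerBl.
Qed.

(** Comparing real parts leaves at most two angles, [acos a] and its mirror image
    [2 * pi - acos a]. *)
Lemma negligible_cis_eq z :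
  mu.-negligible [set t | `[0, 2 * pi]%classic t /\ modulus (cis t - z) = 0].
Proof.
case: z => a b.
apply: (@negligibleS _ _ _ mu ([set acos a] `|` [set 2 * pi - acos a])).
  move=> t [ht /Normc.eq0_normc/eqP]; rewrite subr_eq0 eq_complex.
  move: ht; rewrite /= in_itv /= => /andP[t0 t2] /andP[/eqP <- _].
  have [tp|tp] := leP t pi; [left|right].
    by rewrite cosK // in_itv /= t0.
  have e : cos (2 * pi - t) = cos t.
    rewrite -[RHS]cosN -[RHS]cosD2pi; congr cos.
    by rewrite addrC mulr_natl.
  rewrite -e cosK; first by rewrite /= opprB addrC subrK.
  by rewrite in_itv /= subr_ge0 t2 /= lerBlDr mulr2n mulrDl mul1r lerD2l ltW.
by apply: negligibleU; apply/negligibleP => //; exact: lebesgue_measure_set1.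
Qed.

End JensenUnit.

(** * Rotation invariance of the Lebesgue measure of the plane *)

Section PlaneRotation.
Context {R : realType}.
Local Notation mu := (@lebesgue_measure R).
Local Notation mu2 := (mu \x mu)%E.
Implicit Types (c s k : R) (f : R * R -> \bar R).
Local Open Scope ereal_scope.

Lemma measurable_translation c : measurable_fun setT (fun x : R => (x + c)%R).
Proof. exact: measurable_funD. Qed.

(** Lebesgue measure is determined by its values on half-open intervals, whose length a translation
    preserves. *)
Lemma lebesgue_measure_translation c (A : set R) : measurable A ->
  pushforward mu (fun x : R => (x + c)%R : measurableTypeR R) A = mu A.
Proof.
have mT := measurable_translation c.
move=> mA; apply/esym/lebesgue_measure_unique => //= _ [[a b]] _ <-.
rewrite /pushforward.
have -> : (fun x : R => (x + c)%R) @^-1` [set` `]a, b]%R] =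
          [set` `](a - c)%R, (b - c)%R]%R].
  by apply/seteqP; split => x /=; rewrite !in_itv /= ltrBlDr lerBrDr.
rewrite !lebesgue_measure_itv /= !lte_fin ltrD2r.
by case: ifP => // _; rewrite -!EFinB; congr EFin; ring.
Qed.

Lemma ge0_integral_translation (f : R -> \bar R) c : measurable_fun setT f ->
  (forall x, 0 <= f x) -> \int[mu]_x f (x + c)%R = \int[mu]_x f x.
Proof.
move=> mf f0; have mT := measurable_translation c.
transitivity (\int[pushforward mu (fun x : R => (x + c)%R : measurableTypeR R)]_x
    f x).
  by rewrite ge0_integral_pushforward // preimage_setT.
by apply: eq_measure_integral => A mA _; exact: lebesgue_measure_translation.
Qed.

(** For each fixed second coordinate the shear is a translation of the first, so Tonelli reduces it
    to the line. *)
Lemma ge0_integral_shear1 f k : measurable_fun setT f -> (forall z, 0 <= f z) ->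
  \int[mu2]_z f (z.1 + k * z.2, z.2)%R = \int[mu2]_z f z.
Proof.
move=> mf f0; rewrite !fubini_tonelli2 //; last first.
  apply: measurableT_comp => //; apply/measurable_fun_pair => //=.
  by apply: measurable_funD => //; exact: measurable_funM.
apply: eq_integral => y _; rewrite /fubini_G /=.
apply: (ge0_integral_translation (f := fun x => f (x, y))) => //.
exact: measurableT_comp.
Qed.

Lemma ge0_integral_shear2 f k : measurable_fun setT f -> (forall z, 0 <= f z) ->
  \int[mu2]_z f (z.1, z.2 + k * z.1)%R = \int[mu2]_z f z.
Proof.
move=> mf f0; rewrite !fubini_tonelli1 //; last first.
  apply: measurableT_comp => //; apply/measurable_fun_pair => //=.
  by apply: measurable_funD => //; exact: measurable_funM.
apply: eq_integral => x _; rewrite /fubini_F /=.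
apply: (ge0_integral_translation (f := fun y => f (x, y))) => //.
exact: measurableT_comp.
Qed.

Definition rot c s (z : R * R) : R * R :=
  (c * z.1 - s * z.2, s * z.1 + c * z.2)%R.

Lemma measurable_rot c s : measurable_fun setT (rot c s).
Proof.
apply/measurable_fun_pair => /=.
  by apply: measurable_funB; exact: measurable_funM.
by apply: measurable_funD; exact: measurable_funM.
Qed.

(* A rotation of angle different from pi is a product of three shears. *)
Let ge0_integral_rot_shears f c s : measurable_fun setT f ->
  (forall z, 0 <= f z) -> (c ^+ 2 + s ^+ 2 = 1)%R -> c != (-1)%R ->
  \int[mu2]_z f (rot c s z) = \int[mu2]_z f z.
Proof.
move=> mf f0 cs c1; have c1' : (1 + c != 0)%R by rewrite addrC addr_eq0.
(* For angle theta this is - tan (theta / 2); the horizontal shears by [k] surround a vertical shear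
   by [s]. It requires c != -1. *)
pose k := (- s / (1 + c))%R.
have ks : (1 + k * s = c)%R.
  have s2 : (s ^+ 2 = (1 - c) * (1 + c))%R.
    by apply: (addrI (c ^+ 2)%R); rewrite cs; ring.
  by rewrite /k mulrAC mulNr -expr2 s2 mulNr mulfK //; ring.
have kc : (k * (1 + c) = - s)%R by rewrite /k divfK.
have m1 : measurable_fun setT (fun z : R * R => (z.1 + k * z.2, z.2)%R).
  apply/measurable_fun_pair => //=.
  by apply: measurable_funD => //; exact: measurable_funM.
have m2 : measurable_fun setT (fun z : R * R => (z.1, z.2 + s * z.1)%R).
  apply/measurable_fun_pair => //=.
  by apply: measurable_funD => //; exact: measurable_funM.
pose g (z : R * R) := f (z.1 + k * z.2, z.2)%R.
have mg : measurable_fun setT g by exact: measurableT_comp.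
pose h (z : R * R) := g (z.1, z.2 + s * z.1)%R.
have mh : measurable_fun setT h by exact: measurableT_comp.
rewrite -(ge0_integral_shear1 k mf f0) -(ge0_integral_shear2 s mg (fun=> f0 _)).
rewrite -(ge0_integral_shear1 k mh (fun=> f0 _)).
apply: eq_integral => -[x y] _; rewrite /h /g /rot /=; congr f; congr pair.
- transitivity (c * x + k * (1 + c) * y)%R; first by rewrite kc; ring.
  by rewrite -ks; ring.
- by rewrite -ks; ring.
Qed.

Lemma ge0_integral_rot f c s : measurable_fun setT f -> (forall z, 0 <= f z) ->
  (c ^+ 2 + s ^+ 2 = 1)%R -> \int[mu2]_z f (rot c s z) = \int[mu2]_z f z.
Proof.
move=> mf f0 cs; have [c1|] := eqVneq c (-1)%R; last exact: ge0_integral_rot_shears.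
have s0 : s = 0%R.
  by apply/eqP; rewrite -sqrf_eq0; apply/eqP; move: cs; rewrite c1; lra.
(* The remaining half-turn is the square of the quarter turn [rot 0 1], to which the shear
   decomposition applies. *)
have i1 : (0 ^+ 2 + 1 ^+ 2 = 1 :> R)%R by ring.
have n1 : 0%R != (-1)%R :> R by rewrite eq_sym oppr_eq0 oner_eq0.
rewrite -(ge0_integral_rot_shears mf f0 i1 n1).
have mfr : measurable_fun setT (f \o rot 0 1).
  by apply: measurableT_comp => //; exact: measurable_rot.
rewrite -(ge0_integral_rot_shears mfr (fun=> f0 _) i1 n1).
apply: eq_integral => -[x y] _; rewrite /= /rot /=; congr f.
by congr pair; rewrite c1 s0; ring.
Qed.

End PlaneRotation.

(** * Area of disks and radial integrals *)

Section DiskArea.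
Context {R : realType}.
Local Notation mu := (@lebesgue_measure R).
Local Notation mu2 := (mu \x mu)%E.
Implicit Types (r s x : R) (z : R * R).

Definition rad z : R := modulus (Complex z.1 z.2).

Lemma measurable_sqrt : measurable_fun setT (@Num.sqrt R).
Proof. by apply: continuous_measurable_fun; exact: sqrt_continuous. Qed.

Lemma measurable_modulus (d : measure_display) (T : measurableType d)
    (f g : T -> R) : measurable_fun setT f -> measurable_fun setT g ->
  measurable_fun setT (fun t => modulus (Complex (f t) (g t))).
Proof.
move=> mf mg; apply: (measurableT_comp measurable_sqrt).
by apply: measurable_funD; apply: measurable_funX.
Qed.

Lemma measurable_rad : measurable_fun setT rad.
Proof. exact: measurable_modulus. Qed.

Lemma measurable_disk s : measurable [set z | rad z < s].
Proof.
have -> : [set z | rad z < s] = rad @^-1` [set` `]-oo, s[].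
  by apply/seteqP; split => z /=; rewrite in_itv.
by rewrite -[X in measurable X]setTI; exact: measurable_rad.
Qed.

(** Describes the vertical section of a disk at [x]. For |x| >= s the right-hand root is 0 by
    convention, and both sides are false. *)
Lemma sqrt_lt s x y : 0 <= s ->
  (Num.sqrt (x ^+ 2 + y ^+ 2) < s) = (`|y| < Num.sqrt (s ^+ 2 - x ^+ 2)).
Proof.
move=> s0; have [e|e] := leP (s ^+ 2 - x ^+ 2) 0.
  rewrite (ler0_sqrtr e) [RHS]ltNge normr_ge0 /=; apply/negbTE; rewrite -leNgt.
  rewrite -[leLHS]ger0_norm // -sqrtr_sqr ler_sqrt; last first.
    by rewrite addr_ge0 ?sqr_ge0.
  by have := sqr_ge0 y; lra.
rewrite -sqrtr_sqr ltr_sqrt // -[X in _ < X]ger0_norm // -[X in _ < X]sqrtr_sqr.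
rewrite ltr_sqrt; first by rewrite ltrBrDl.
by have := sqr_ge0 x; lra.
Qed.

(** The substitution x = s sin u turns the integrand into 2 s^2 cos^2 u, with antiderivative s^2 (u
    + sin u cos u). *)
Lemma half_circle_integral s : 0 < s ->
  (\int[mu]_(x in `[(- s)%R, s]) (2 * Num.sqrt (s ^+ 2 - x ^+ 2))%:E =
   (pi * s ^+ 2)%:E)%E.
Proof.
move=> s0; pose F u := s * sin u.
have dF (u : R) : is_derive u (1 : R) F (s * cos u).
  by apply: is_derive_eq; rewrite /GRing.scale /=.
have F'E : (F^`())%classic = (fun u => s * cos u).
  by apply/funext => u; rewrite derive1E derive_val.
have cF : continuous F.
  by move=> u; apply: differentiable_continuous; apply/derivable1_diffP.
have cF' : continuous (fun u : R => s * cos u).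
  by move=> u; apply: cvgM; [exact: cvg_cst|exact: continuous_cos].
have cG : continuous (fun x => 2 * Num.sqrt (s ^+ 2 - x ^+ 2)).
  move=> x; apply: cvgM; first exact: cvg_cst.
  apply: (@continuous_comp R R R (fun x => s ^+ 2 - x ^+ 2) Num.sqrt).
    by apply: cvgB; [exact: cvg_cst|exact: exprn_continuous].
  exact: sqrt_continuous.
have p0 : - (pi / 2) < pi / 2 :> R by have := @pi_gt0 R; lra.
have Fa : F (- (pi / 2)) = - s by rewrite /F sinN sin_pihalf mulrN1.
have Fb : F (pi / 2) = s by rewrite /F sin_pihalf mulr1.
transitivity (\int[mu]_(x in `[F (- (pi / 2))%R, F (pi / 2)%R])
  (2 * Num.sqrt (s ^+ 2 - x ^+ 2))%:E)%E; first by rewrite Fa Fb.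
rewrite (@integration_by_substitution_increasing R F
  (fun x => 2 * Num.sqrt (s ^+ 2 - x ^+ 2)) (- (pi / 2)) (pi / 2)) //=; first last.
- exact: continuous_subspaceT.
- split=> [x _||]; first by case: (dF x).
  + by apply: cvg_at_right_filter; exact: cF.
  + by apply: cvg_at_left_filter; exact: cF.
- rewrite F'E; apply/cvg_ex; exists (s * cos (pi / 2)).
  by apply: cvg_at_left_filter; exact: cF'.
- rewrite F'E; apply/cvg_ex; exists (s * cos (- (pi / 2))).
  by apply: cvg_at_right_filter; exact: cF'.
- by move=> x _; rewrite F'E; exact: cF'.
- by move=> x y hx hy xy; rewrite /F ltr_pM2l // ltr_sin.
- exact: ltW.
pose f u := s ^+ 2 * (2 * cos u ^+ 2).
pose H u := s ^+ 2 * (u + sin u * cos u).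
have dH (u : R) : is_derive u (1 : R) H (f u).
  apply: is_derive_eq; rewrite /GRing.scale /= /f; congr (_ * _).
  by have := cos2Dsin2 u; nra.
have cH : continuous H.
  by move=> u; apply: differentiable_continuous; apply/derivable1_diffP.
transitivity (\int[mu]_(x in `[(- (pi / 2))%R, (pi / 2)%R]) (f x)%:E)%E.
  apply: eq_integral => x; rewrite inE /= in_itv /= => /andP[x1 x2].
  congr EFin; rewrite F'E fctE /= /f /F.
  have -> : s ^+ 2 - (s * sin x) ^+ 2 = (s * cos x) ^+ 2.
    by have := cos2Dsin2 x; nra.
  have c0 : 0 <= cos x by apply: cos_ge0_pihalf; rewrite x1.
  by rewrite sqrtr_sqr ger0_norm ?mulr_ge0 ?(ltW s0) //; ring.
rewrite (@continuous_FTC2 R f H) //.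
- rewrite /H -EFinB; congr EFin; rewrite sinN cosN cos_pihalf; lra.
- apply: continuous_subspaceT => u; apply: cvgM; first exact: cvg_cst.
  apply: cvgM; first exact: cvg_cst.
  by apply: (cvg_comp (@cos R) (fun x => x ^+ 2));
    [exact: continuous_cos|exact: exprn_continuous].
- split=> [x _||]; first by case: (dH x).
  + by apply: cvg_at_right_filter; exact: cH.
  + by apply: cvg_at_left_filter; exact: cH.
- by move=> x _; rewrite derive1E derive_val.
Qed.

(** The vertical sections are intervals of length 2 sqrt (s^2 - x^2), empty outside [[- s, s]];
    [half_circle_integral] sums them. *)
Lemma disk_area s : 0 < s -> mu2 [set z | rad z < s] = (pi * s ^+ 2)%:E.
Proof.
move=> s0; rewrite -half_circle_integral // integral_mkcond.
apply: eq_integral => x _ /=.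
have -> : xsection [set z | rad z < s] x =
    [set` `](- Num.sqrt (s ^+ 2 - x ^+ 2)), (Num.sqrt (s ^+ 2 - x ^+ 2))[].
  apply/seteqP; split => y; rewrite /xsection /= inE /= in_itv /= /rad /=;
  by rewrite sqrt_lt ?(ltW s0) // ltr_norml.
rewrite lebesgue_measure_itv /= lte_fin.
have := sqrtr_ge0 (s ^+ 2 - x ^+ 2); set q := Num.sqrt _ => q0.
transitivity (2 * q)%:E.
  case: ifPn => [_|]; first by congr EFin; ring.
  by rewrite -leNgt => qN; congr EFin; lra.
rewrite patchE; case: ifPn => // xs.
suff -> : q = 0 by rewrite mulr0.
apply: ler0_sqrtr; move: xs; rewrite notin_setE /= in_itv /= => /negP.
rewrite -ler_norml -ltNge => xs.
by rewrite subr_le0 -(real_normK (num_real x)) ler_sqr ?nnegrE ?normr_ge0 ?ltW.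
Qed.

Lemma measurable_circle r : measurable [set z | rad z = r].
Proof.
have -> : [set z | rad z = r] = rad @^-1` [set r] by [].
by rewrite -[X in measurable X]setTI; exact: measurable_rad.
Qed.

(** Each vertical section has at most two points. *)
Lemma circle_null r : mu2 [set z | rad z = r] = 0%E.
Proof.
transitivity (\int[mu]_x 0)%E; last exact: integral0.
apply: eq_integral => x _ /=.
apply/(@negligibleP _ _ _ mu).
  by apply: measurable_xsection; exact: measurable_circle.
apply: (@negligibleS _ _ _ mu
  ([set Num.sqrt (r ^+ 2 - x ^+ 2)] `|` [set - Num.sqrt (r ^+ 2 - x ^+ 2)])).
  move=> y; rewrite /xsection /= inE /= /rad /= => <-.
  rewrite sqr_sqrtr ?addr_ge0 ?sqr_ge0 // addrAC subrr add0r sqrtr_sqr.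
  by have [y0|y0] := ger0P y; [left|right]; rewrite ?opprK.
by apply: negligibleU; apply/negligibleP => //; exact: lebesgue_measure_set1.
Qed.

End DiskArea.

(** * Tonelli's theorem on the product of the plane and the line *)

Section PlaneTonelli.
Context {R : realType}.
Local Notation mu := (@lebesgue_measure R).
Local Notation mu2 := (mu \x mu)%E.

Lemma sigma_finite_plane : sigma_finite setT mu2.
Proof.
exists (fun n => [set z | rad z < n.+1%:R]).
  apply/esym/seteqP; split => // z _; exists (Num.truncn (rad z)) => //=.
  exact: truncnS_gt.
move=> n; split; first exact: measurable_disk.
by rewrite disk_area ?ltry.
Qed.

(* The canonical sigma-finite structure that the library infers for a product
   measure expects subprobabilities, hence the explicit packing. *)
Definition plane_measure :
    {sigma_finite_measure set (measurableTypeR R * measurableTypeR R)%type ->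
       \bar R} :=
  HB.pack mu2 (Measure_isSigmaFinite.Build _ _ _ mu2 sigma_finite_plane).

Lemma tonelli_plane (K : (R * R) * R -> \bar R) : measurable_fun setT K ->
  (forall p, 0 <= K p)%E ->
  (\int[mu2]_z \int[mu]_s K (z, s) = \int[mu]_s \int[mu2]_z K (z, s))%E.
Proof. by move=> mK K0; exact: (@fubini_tonelli _ _ _ _ _ plane_measure mu K). Qed.

End PlaneTonelli.

(** * Integration of a radial logarithm over the unit disk *)

Section RadialIntegral.
Context {R : realType}.
Local Notation mu := (@lebesgue_measure R).
Local Notation mu2 := (mu \x mu)%E.
Implicit Types (m s rho : R).

Lemma integral_inv m : 0 < m <= 1 ->
  (\int[mu]_(s in `]m, 1%R]) (s^-1)%:E = (- ln m)%:E)%E.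
Proof.
case/andP=> m0; rewrite le_eqVlt => /predU1P[->|m1].
  by rewrite set_itvoc0 integral_set0 ln1 oppr0.
have ci (s : R) : m <= s -> {for s, continuous (@GRing.inv R)}.
  by move=> ms; apply: inv_continuous; rewrite gt_eqF // (lt_le_trans m0).
have cl (s : R) : m <= s -> {for s, continuous (@ln R)}.
  by move=> ms; apply: continuous_ln; rewrite (lt_le_trans m0).
have cw : {within `[m, 1], continuous (@GRing.inv R)}.
  apply: continuous_in_subspaceT => s; rewrite inE /= in_itv /= => /andP[ms _].
  exact: ci.
rewrite integral_itv_obnd_cbnd; last first.
  apply/measurable_EFinP.
  apply: (measurable_funS (E := `[m, 1]%classic)) => //.
    exact: subset_itv_oc_cc.
  exact: subspace_continuous_measurable_fun.
rewrite (@continuous_FTC2 R (@GRing.inv R) (@ln R)) ?ln1 ?sub0e //.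
- split=> [s||].
  + rewrite in_itv /= => /andP[ms _].
    by have [] := is_derive1_ln (lt_trans m0 ms).
  + by apply: cvg_at_right_filter; exact: cl.
  + by apply: cvg_at_left_filter; apply: cl; exact: ltW.
- move=> s; rewrite in_itv /= => /andP[ms _]; rewrite derive1E.
  by have [_ ->] := is_derive1_ln (lt_trans m0 ms).
Qed.

Lemma integral_linear rho : 0 < rho < 1 ->
  (\int[mu]_(s in `]rho, 1%R]) (pi * s)%:E = (pi * (1 - rho ^+ 2) / 2)%:E)%E.
Proof.
case/andP=> r0 r1.
have cf : continuous (fun s : R => pi * s).
  by move=> s; apply: cvgM; [exact: cvg_cst|exact: cvg_id].
pose F s : R := pi / 2 * s ^+ 2.
have dF (s : R) : is_derive s (1 : R) F (pi * s).
  by apply: is_derive_eq; rewrite /GRing.scale /=; lra.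
have cF : continuous F.
  by move=> u; apply: differentiable_continuous; apply/derivable1_diffP.
rewrite integral_itv_obnd_cbnd; last first.
  by apply/measurable_EFinP/measurable_funTS; exact: continuous_measurable_fun.
rewrite (@continuous_FTC2 R (fun s => pi * s) F) //.
- by rewrite -EFinB /F; congr EFin; lra.
- exact: continuous_subspaceT.
- split=> [x _||]; first by case: (dF x).
  + by apply: cvg_at_right_filter; exact: cF.
  + by apply: cvg_at_left_filter; exact: cF.
- by move=> x _; rewrite derive1E derive_val.
Qed.

(* Layer cake: - ln max(|z|, rho) is the integral of 1/s over the s in ]rho, 1]
   with |z| < s, and the disk of radius s has area pi s ^+ 2. *)
Lemma radial_integral rho : 0 < rho < 1 ->
  (\int[mu2]_(z in [set z | (rad z < 1)%R]) (- ln (Num.max (rad z) rho))%:E =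
   (pi * (1 - rho ^+ 2) / 2)%:E)%E.
Proof.
move=> r01; have /andP[r0 r1] := r01.
pose E : set ((R * R) * R) := [set p | (rho < p.2 <= 1) && (rad p.1 < p.2)].
pose K : (R * R) * R -> \bar R := (fun p => (p.2^-1)%:E) \_ E.
have mE : measurable E.
  have -> : E = (snd @^-1` `]rho, 1]) `&`
      ((fun p : (R * R) * R => p.2 - rad p.1) @^-1` `]0, +oo[).
    apply/seteqP; split => p; rewrite /E /= !in_itv /= andbT subr_gt0.
      by move/andP.
    by case=> -> ->.
  apply: measurableI.
    by rewrite -[X in measurable X]setTI; exact: measurable_snd.
  rewrite -[X in measurable X]setTI.
  have mf : measurable_fun setT (fun p : (R * R) * R => p.2 - rad p.1).
    apply: measurable_funB => //.
    by apply: measurableT_comp; [exact: measurable_rad|exact: measurable_fst].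
  exact: mf.
have mK : measurable_fun setT K.
  apply/(measurable_restrictT _ mE).
  (* On [E] the second coordinate is positive, so the inverse may be replaced by a composite of
     functions measurable everywhere. *)
  apply: (eq_measurable_fun (fun p : (R * R) * R => (expR (- ln p.2))%:E)).
    move=> p; rewrite inE /E /= => /andP[/andP[h _] _].
    by rewrite expRN lnK // posrE (lt_trans r0).
  apply/measurable_EFinP/measurable_funTS.
  by do 3 apply: measurableT_comp => //.
have K0 p : (0 <= K p)%E.
  rewrite /K patchE; case: ifPn => //; rewrite inE /E /= => /andP[/andP[h _] _].
  by rewrite lee_fin invr_ge0 ltW // (lt_trans r0).
have : (\int[mu2]_z \int[mu]_s K (z, s) = \int[mu]_s \int[mu2]_z K (z, s))%E.
  exact: tonelli_plane.
have -> : (\int[mu]_s \int[mu2]_z K (z, s) =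
    \int[mu]_(s in `]rho, 1%R]) (pi * s)%:E)%E.
  rewrite [RHS]integral_mkcond; apply: eq_integral => s _; rewrite patchE.
  case: ifPn => hs.
    have /andP[s0 s1] : rho < s <= 1 by move: hs; rewrite inE /= in_itv.
    have sp : 0 < s := lt_trans r0 s0.
    transitivity (\int[mu2]_(z in [set z | (rad z < s)%R]) (s^-1)%:E)%E.
      rewrite [RHS]integral_mkcond; apply: eq_integral => z _.
      rewrite /K !patchE; congr (if _ then _ else _).
      by apply/idP/idP; rewrite !inE /E /= s0 s1.
    rewrite integral_cst; last exact: measurable_disk.
    rewrite [X in (_ * X)%E](disk_area sp) -EFinM; congr EFin.
    by rewrite mulrCA expr2 mulKf // gt_eqF.
  rewrite integral0_eq // => z _.
  rewrite /K patchE ifN // notin_setE /E /= => /andP[h _].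
  by move: hs; rewrite notin_setE /= in_itv /= h.
rewrite integral_linear // => <-.
rewrite [LHS]integral_mkcond; apply: eq_integral => z _; rewrite patchE.
set m := Num.max (rad z) rho.
(* For fixed [z] the admissible levels form []m, 1]]. This interval is empty when |z| >= 1, which
   matches the extension by 0 outside the disk. *)
have -> : (\int[mu]_s K (z, s) = \int[mu]_(s in `]m, 1%R]) (s^-1)%:E)%E.
  rewrite [RHS]integral_mkcond; apply: eq_integral => s _.
  rewrite /K !patchE; congr (if _ then _ else _).
  apply/idP/idP; rewrite !inE /E /= in_itv /= /m gt_max.
    by case/andP => /andP[-> ->] ->.
  by case/andP => /andP[-> ->] ->.
case: ifPn => hz.
  have z1 : rad z < 1 by move: hz; rewrite inE.
  rewrite integral_inv // /m lt_max r0 orbT /= ge_max !ltW //.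
rewrite set_itv_ge ?integral_set0 // -leNgt bnd_simp /m le_max.
by move: hz; rewrite notin_setE /= => /negP; rewrite -leNgt => ->.
Qed.

End RadialIntegral.

(** * Integral of a logarithm over the unit disk *)

Section DiskLogIntegral.
Context {R : realType}.
Local Notation mu := (@lebesgue_measure R).
Local Notation mu2 := (mu \x mu)%E.
Implicit Types (t c : R) (z : R * R) (a w : R[i]).

Lemma EFin_Rintegral (d : measure_display) (T : measurableType d)
    (m : {measure set T -> \bar R}) (A : set T) (f : T -> R) :
  measurable A -> m.-integrable A (EFin \o f) ->
  (\int[m]_(x in A) (f x)%:E = (\int[m]_(x in A) f x)%R%:E)%E.
Proof. by move=> mA fi; rewrite /Rintegral fineK //; exact: integrable_fin_num. Qed.

Lemma integrableB_EFin (d : measure_display) (T : measurableType d)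
    (m : {measure set T -> \bar R}) (A : set T) (f g : T -> R) :
  measurable A -> m.-integrable A (EFin \o f) -> m.-integrable A (EFin \o g) ->
  m.-integrable A (EFin \o (fun x => f x - g x)).
Proof. by move=> mA fi gi; have := integrableB mA fi gi. Qed.

Lemma integrable_cst_EFin (d : measure_display) (T : measurableType d)
    (m : {measure set T -> \bar R}) (A : set T) (c : R) :
  measurable A -> (m A < +oo)%E -> m.-integrable A (EFin \o (fun=> c)).
Proof.
move=> mA mAoo; apply/integrableP; split; first exact/measurable_EFinP.
rewrite (_ : (fun x => _) = cst `|c|%:E) //= integral_cst //.
by rewrite lte_mul_pinfty.
Qed.

(** Stated for extended reals because the factor [2 * pi] is cancelled before the integrals are
    known to be finite. *)
Lemma mule_pinj (r : R) (x y : \bar R) : 0 < r ->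
  (r%:E * x = r%:E * y)%E -> x = y.
Proof.
move=> r0 e; have m := @lee_pmul2l R r%:E isT r0.
by apply: le_anti; rewrite -(m x y) -(m y x) e lexx.
Qed.

(** Factoring out [w] gives |cis t * w - a| = |w| |cis t - a / w|. As |w| != |a|, the point [a / w]
    is off the unit circle and [jensen] applies. *)
Lemma circle_mean a w c : a != 0 -> modulus w != modulus a ->
  (\int[mu]_(t in `[0%R, (2 * pi)%R]) (c - ln (modulus (cis t * w - a)))%:E =
   (2 * pi * (c - ln (Num.max (modulus w) (modulus a))))%:E)%E.
Proof.
move=> a0 wa; have ma : 0 < modulus a by rewrite modulus_gt0.
have cc (x : R) : mu.-integrable `[0, 2 * pi] (EFin \o (fun=> x)).
  by apply: (@continuous_integrable_itv R (cst x)) => t; exact: cst_continuous.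
(* At w = 0 the quotient [a / w] is meaningless, but the integrand is constant. *)
have [w0|w0] := eqVneq w 0.
  rewrite w0 Normc.normc0 (max_idPr (ltW ma)).
  rewrite -Rintegral_cst_circle -EFin_Rintegral //.
  by apply: eq_integral => t _; rewrite mulr0 sub0r modulusN.
have mw : 0 < modulus w by rewrite modulus_gt0.
pose b := a / w.
have mb : modulus b = modulus a / modulus w by rewrite Normc.normcM Normc.normcV.
have b1 : modulus b != 1.
  by apply: contra wa => /eqP; rewrite mb => /divr1_eq ->.
have E t : c - ln (modulus (cis t * w - a)) = (c - ln (modulus w)) - lncis b t.
  have -> : cis t * w - a = w * (cis t - b).
    by rewrite mulrBr mulrC /b mulrCA divff ?mulr1.
  by rewrite Normc.normcM lnM ?posrE // ?modulus_cisB_gt0 // opprD addrA.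
under eq_integral do rewrite E.
rewrite (@EFin_Rintegral _ _ mu _ (fun t => (c - ln (modulus w)) - lncis b t)) //;
  last first.
  by apply: integrableB_EFin => //; exact: integrable_lncis.
rewrite RintegralB //; last exact: integrable_lncis.
rewrite Rintegral_cst_circle -/(int_lncis b) jensen //; congr EFin.
rewrite -mulrBr; congr (_ * _); rewrite -addrA -opprD; congr (_ - _).
rewrite -lnM ?posrE ?lt_max ?ltr01 //; congr ln.
by rewrite maxr_pMr ?(ltW mw) // mulr1 mb mulrC divfK // gt_eqF.
Qed.

Lemma rot_cis t z :
  Complex (rot (cos t) (sin t) z).1 (rot (cos t) (sin t) z).2 =
  cis t * Complex z.1 z.2.
Proof. by apply/eqP; rewrite eq_complex /= eqxx addrC eqxx. Qed.

Lemma rad_rot t z : rad (rot (cos t) (sin t) z) = rad z.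
Proof. by rewrite /rad rot_cis Normc.normcM modulus_cis mul1r. Qed.

Lemma measurable_modulus_sub a :
  measurable_fun setT (fun z => modulus (Complex z.1 z.2 - a)).
Proof.
case: a => x y; apply: (measurable_modulus (f := fun z => z.1 - x)
  (g := fun z => z.2 - y)); exact: measurable_funB.
Qed.

(** Closed form of the integral of ln |z - a| over the unit disk, that is [pi] times the mean; see
    [disk_log_integral]. *)
Definition disk_log a : R :=
  if modulus a < 1 then pi * (modulus a ^+ 2 - 1) / 2 else pi * ln (modulus a).

Let D : set (R * R) := [set z | rad z < 1].

(** Averaging over all rotations leaves the left integral unchanged, and exchanging the integrals
    replaces the integrand by its circle mean. The bound on [c] makes the integrand nonnegative, so
    Tonelli applies before integrability is known. *)
Lemma disk_log_mean a c : a != 0 -> ln (1 + modulus a) <= c ->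
  (\int[mu2]_(z in D) (c - ln (modulus (Complex z.1 z.2 - a)))%:E =
   \int[mu2]_(z in D) (c - ln (Num.max (rad z) (modulus a)))%:E)%E.
Proof.
move=> a0 hc; have ma : 0 < modulus a by rewrite modulus_gt0.
have c0 : 0 <= c by apply: le_trans hc; rewrite ln_ge0 // lerDl ltW.
have mD : measurable D := measurable_disk 1.
have pi2 : 0 < 2 * pi :> R by rewrite mulr_gt0 // pi_gt0.
pose h z : \bar R := (c - ln (modulus (Complex z.1 z.2 - a)))%:E.
have mh : measurable_fun setT h.
  apply/measurable_EFinP/measurable_funB => //; apply: measurableT_comp => //.
  exact: measurable_modulus_sub.
pose H := h \_ D.
have mH : measurable_fun setT H.
  by apply/(measurable_restrictT _ mD); exact: measurable_funTS.
have H0 z : (0 <= H z)%E.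
  rewrite /H patchE; case: ifPn => //; rewrite inE /D /= => z1.
  rewrite lee_fin subr_ge0.
  have [e|e] := eqVneq (modulus (Complex z.1 z.2 - a)) 0; first by rewrite e ln0.
  apply: le_trans hc; rewrite ler_ln ?posrE ?lt_def ?e ?modulus_ge0 //.
    by apply: le_trans (modulusB_le _ _) _; rewrite lerD2r ltW.
  by rewrite addr_ge0 ?modulus_ge0 // andbT gt_eqF // ltr_wpDr ?modulus_ge0.
pose I : set ((R * R) * R) := snd @^-1` `[0, 2 * pi].
pose K : (R * R) * R -> \bar R :=
  (fun p => H (rot (cos p.2) (sin p.2) p.1)) \_ I.
have mI : measurable I.
  by rewrite -[X in measurable X]setTI; exact: measurable_snd.
have mK : measurable_fun setT K.
  apply/(measurable_restrictT _ mI)/measurable_funTS.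
  apply: measurableT_comp => //; apply/measurable_fun_pair => /=.
    apply: measurable_funB; apply: measurable_funM.
    - apply: (measurableT_comp (f := @cos R)) => //.
      by apply: continuous_measurable_fun; exact: continuous_cos.
    - by apply: measurableT_comp.
    - apply: (measurableT_comp (f := @sin R)) => //.
      by apply: continuous_measurable_fun; exact: continuous_sin.
    - by apply: measurableT_comp.
  apply: measurable_funD; apply: measurable_funM.
  - apply: (measurableT_comp (f := @sin R)) => //.
    by apply: continuous_measurable_fun; exact: continuous_sin.
  - by apply: measurableT_comp.
  - apply: (measurableT_comp (f := @cos R)) => //.
    by apply: continuous_measurable_fun; exact: continuous_cos.
  - by apply: measurableT_comp.
have K0 p : (0 <= K p)%E by rewrite /K patchE; case: ifPn.
have : (\int[mu2]_z \int[mu]_t K (z, t) = \int[mu]_t \int[mu2]_z K (z, t))%E.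
  exact: tonelli_plane.
(* By rotation invariance the inner integral is the same for every angle, so the angles contribute
   the factor [2 * pi]. *)
have -> : (\int[mu]_t \int[mu2]_z K (z, t) =
    (2 * pi)%:E * \int[mu2]_(z in D) h z)%E.
  transitivity (\int[mu]_(t in `[0%R, (2 * pi)%R]) \int[mu2]_z H z)%E.
    rewrite [RHS]integral_mkcond; apply: eq_integral => t _; rewrite patchE.
    case: ifPn => ht.
      rewrite -(@ge0_integral_rot R H (cos t) (sin t)) ?cos2Dsin2 //.
      by apply: eq_integral => z _; rewrite /K patchE ifT.
    by rewrite integral0_eq // => z _; rewrite /K patchE ifN.
  have -> : (\int[mu2]_z H z = \int[mu2]_(z in D) h z)%E.
    by rewrite [RHS]integral_mkcond.
  move: (\int[mu2]_(z in D) h z)%E => J.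
  rewrite integral_cst // muleC; congr (_ * _)%E.
  have /= -> := @lebesgue_measure_itv R `[0, 2 * pi]%R.
  by rewrite lte_fin pi2 sube0.
have -> : (\int[mu2]_z \int[mu]_t K (z, t) =
    (2 * pi)%:E * \int[mu2]_(z in D) (c - ln (Num.max (rad z) (modulus a)))%:E)%E.
  rewrite -ge0_integralZl //; first last.
  - by rewrite lee_fin ltW.
  - move=> z; rewrite /D /= => z1; rewrite lee_fin subr_ge0.
    apply: le_trans hc; rewrite ler_ln ?posrE ?lt_max ?ma ?orbT ?addr_gt0 //.
    by rewrite ge_max lerDr ler01 andbT (le_trans (ltW z1)) // lerDl ltW.
  - apply/measurable_funTS/measurable_EFinP/measurable_funB => //.
    apply: measurableT_comp => //; apply: measurable_maxr => //.
    exact: measurable_rad.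
  rewrite [RHS]integral_mkcond; apply: ae_eq_integral => //.
  - exact: (@measurable_fun_fubini_tonelli_F _ _ _ _ _ mu K mK K0).
  - apply/(measurable_restrictT _ mD)/measurable_funTS.
    apply/measurable_EFinP; apply: measurable_funM => //.
    apply: measurable_funB => //.
    apply: measurableT_comp => //; apply: measurable_maxr => //.
    exact: measurable_rad.
  (* [circle_mean] says nothing on the circle |z| = |a|, which is a null set. *)
  exists [set z | rad z = modulus a]; split.
  - exact: measurable_circle.
  - exact: circle_null.
  - move=> z /= /not_implyP[_]; apply: contra_notP => za.
    have HE t : H (rot (cos t) (sin t) z) = if z \in D then
        (c - ln (modulus (cis t * Complex z.1 z.2 - a)))%:E else 0%E.
      rewrite /H patchE /h rot_cis; congr (if _ then _ else _).
      by apply/idP/idP; rewrite !inE /D /= rad_rot.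
    have -> : (\int[mu]_t K (z, t) = \int[mu]_(t in `[0%R, (2 * pi)%R])
        (if z \in D then (c - ln (modulus (cis t * Complex z.1 z.2 - a)))%:E
         else 0))%E.
      rewrite [RHS]integral_mkcond; apply: eq_integral => t _.
      by rewrite /K !patchE HE.
    rewrite patchE; case: ifPn => hz; last by rewrite integral0.
    by rewrite circle_mean //; exact/eqP.
by move/(mule_pinj pi2).
Qed.

Lemma disk_area1 : mu2 D = pi%:E.
Proof. by rewrite /D disk_area // expr1n mulr1. Qed.

(** For |a| >= 1 the maximum is the constant |a| on the disk; for |a| < 1 [radial_integral] applies
    with radius |a|. *)
Lemma disk_log_shift a c : a != 0 -> ln (1 + modulus a) <= c ->
  (\int[mu2]_(z in D) (c - ln (modulus (Complex z.1 z.2 - a)))%:E =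
   (pi * c - disk_log a)%:E)%E.
Proof.
move=> a0 hc; have ma : 0 < modulus a by rewrite modulus_gt0.
have c0 : 0 <= c by apply: le_trans hc; rewrite ln_ge0 // lerDl ltW.
have mD : measurable D := measurable_disk 1.
rewrite disk_log_mean // /disk_log; case: ifPn => [a1|].
  under eq_integral do rewrite EFinD.
  rewrite ge0_integralD //; first last.
  - apply/measurable_funTS/measurable_EFinP/measurableT_comp => //.
    apply: measurableT_comp => //; apply: measurable_maxr => //.
    exact: measurable_rad.
  - move=> z; rewrite /D /= => z1; rewrite lee_fin oppr_ge0 ln_le0 //.
    by rewrite ge_max !ltW.
  rewrite radial_integral ?ma // integral_cst // [X in (_ * X + _)%E]disk_area1.
  by rewrite -EFinM -EFinD; congr EFin; lra.
rewrite -leNgt => a1.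
transitivity (\int[mu2]_(z in D) (c - ln (modulus a))%:E)%E.
  apply: eq_integral => z; rewrite inE /D /= => z1.
  by rewrite (max_idPr _) // ltW // (lt_le_trans z1).
rewrite integral_cst // [X in (_ * X)%E]disk_area1 -EFinM; congr EFin; ring.
Qed.

Lemma disk_log_integral a : a != 0 ->
  mu2.-integrable D (EFin \o (fun z => ln (modulus (Complex z.1 z.2 - a)))) /\
  \int[mu2]_(z in D) ln (modulus (Complex z.1 z.2 - a)) = disk_log a.
Proof.
move=> a0; have ma : 0 < modulus a by rewrite modulus_gt0.
have mD : measurable D := measurable_disk 1.
(* This [c] dominates [f] on the disk, also at z = a where [f] is 0 by convention. Thus [c - f] is
   nonnegative with finite integral, and [f] is recovered as c - (c - f). *)
pose c := ln (1 + modulus a); pose f z := ln (modulus (Complex z.1 z.2 - a)).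
have mf : measurable_fun setT f.
  by apply: measurableT_comp => //; exact: measurable_modulus_sub.
have Ig := disk_log_shift a0 (lexx c).
have fc z : D z -> f z <= c.
  rewrite /D /= => z1; rewrite /f.
  have [e|e] := eqVneq (modulus (Complex z.1 z.2 - a)) 0.
    by rewrite e ln0 // ln_ge0 // lerDl ltW.
  rewrite ler_ln ?posrE ?lt_def ?e ?modulus_ge0 //.
    by apply: le_trans (modulusB_le _ _) _; rewrite lerD2r ltW.
  by rewrite addr_ge0 ?modulus_ge0 // andbT gt_eqF // ltr_wpDr ?modulus_ge0.
have ig : mu2.-integrable D (EFin \o (fun z => c - f z)).
  apply/integrableP; split.
    by apply/measurable_funTS/measurable_EFinP/measurable_funB.
  apply: le_lt_trans (ltry (pi * c - disk_log a)); rewrite -Ig.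
  rewrite le_eqVlt; apply/orP; left; apply/eqP; apply: eq_integral => z.
  by rewrite inE => Dz /=; rewrite ger0_norm // subr_ge0 fc.
have ic : mu2.-integrable D (EFin \o (fun=> c)).
  by apply: integrable_cst_EFin => //; rewrite [X in (X < _)%E]disk_area1 ltry.
have fE : f = (fun z => c - (c - f z)).
  by apply/funext => z; rewrite opprB addrC subrK.
split; first by rewrite -/f fE; exact: integrableB_EFin.
rewrite -/(f _) [X in Rintegral _ _ X](_ : _ = fun z => c - (c - f z)) //.
rewrite RintegralB // Rintegral_cst // [X in fine X]disk_area1 /=.
rewrite [X in _ - X](_ : _ = pi * c - disk_log a); first by ring.
by rewrite /Rintegral Ig.
Qed.

End DiskLogIntegral.

(** * Mahler measures in terms of the roots *)

Section LogProduct.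
Context {R : realType} (d : measure_display) (T : measurableType d).
Variables (m : {measure set T -> \bar R}) (A : set T) (I : eqType).
Hypothesis mA : measurable A.
Implicit Types (s : seq I) (f : I -> T -> R).

Lemma Rintegral_sum s f :
  {in s, forall i, m.-integrable A (EFin \o f i)} ->
  m.-integrable A (EFin \o (fun x => \sum_(i <- s) f i x)) /\
  \int[m]_(x in A) (\sum_(i <- s) f i x) = \sum_(i <- s) \int[m]_(x in A) f i x.
Proof.
elim: s => [_|i s IH fi].
  have -> : (fun x => \sum_(i <- [::]) f i x) = (fun=> 0).
    by apply/funext => x; rewrite big_nil.
  split; last by rewrite Rintegral_cst // mul0r big_nil.
  exact: integrable0.
have [sI sE] := IH (fun j js => fi j (mem_behead (s := i :: s) js)).
have iI := fi i (mem_head _ _).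
have -> : (fun x => \sum_(j <- i :: s) f j x) =
    (fun x => f i x + \sum_(j <- s) f j x).
  by apply/funext => x; rewrite big_cons.
split; last by rewrite RintegralD // sE big_cons.
by have := integrableD mA iI sI.
Qed.

Lemma negligible_seq s f :
  {in s, forall i, m.-negligible [set x | A x /\ f i x = 0]} ->
  m.-negligible [set x | A x /\ exists2 i, i \in s & f i x = 0].
Proof.
elim: s => [_|i s IH fN].
  by apply: negligibleS (negligible_set0 m) => x [_ [? //]].
apply: negligibleS (negligibleU (fN i (mem_head _ _))
  (IH (fun j js => fN j (mem_behead (s := i :: s) js)))).
move=> x [Ax [j]]; rewrite inE => /orP[/eqP ->|js] fj0; first by left.
by right; split => //; exists j.
Qed.

(* At a zero of some [f i] both sides take junk values ([ln 0 = 0]). *)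
Lemma Rintegral_ln_prod s f (c : R) : 0 < c -> (m A < +oo)%E ->
  (forall i, measurable_fun setT (f i)) -> (forall i x, 0 <= f i x) ->
  {in s, forall i, m.-integrable A (EFin \o (fun x => ln (f i x)))} ->
  {in s, forall i, m.-negligible [set x | A x /\ f i x = 0]} ->
  \int[m]_(x in A) ln (c * \prod_(i <- s) f i x) =
  ln c * fine (m A) + \sum_(i <- s) \int[m]_(x in A) ln (f i x).
Proof.
move=> c0 mAoo mf f0 fi fN.
have [sI sE] := Rintegral_sum (f := fun i x => ln (f i x)) fi.
have cI := integrable_cst_EFin (ln c) mA mAoo.
rewrite -sE -Rintegral_cst // -RintegralD //; congr fine.
apply: ae_eq_integral => //.
- apply/measurable_funTS/measurable_EFinP; apply: measurableT_comp => //.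
  apply: measurable_funM => //.
  by apply: measurable_prod => i _.
- apply/measurable_funTS/measurable_EFinP; apply: measurable_funD => //.
  by apply: measurable_sum => i; exact: measurableT_comp.
apply: negligibleS (negligible_seq fN) => x /= /not_implyP[Ax].
move=> h; split => //; apply: contrapT => nz; apply: h; congr EFin.
have fp i : i \in s -> 0 < f i x.
  move=> si; rewrite lt_def f0 andbT; apply/eqP => e; apply: nz.
  by exists i.
have [pp ->] : 0 < \prod_(i <- s) f i x /\
    \sum_(i <- s) ln (f i x) = ln (\prod_(i <- s) f i x).
  elim: s fp {fi fN sI sE nz} => [|i s IH] fp; first by rewrite !big_nil ln1.
  have [p0 e] := IH (fun j js => fp j (mem_behead (s := i :: s) js)).
  have fi0 := fp i (mem_head _ _).
  by rewrite !big_cons e mulr_gt0 // lnM.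
by rewrite lnM.
Qed.

End LogProduct.

(** * A second-order bound for the exponential and its logarithmic form *)

Section Inequality.
Context {R : realType}.
Implicit Types x r : R.

(** The left side is a partial sum of the exponential series, whose terms are nonnegative. *)
Lemma expR_ge2 x : 0 <= x -> 1 + x + x ^+ 2 / 2 <= expR x.
Proof.
move=> x0; have -> : 1 + x + x ^+ 2 / 2 = series (exp_coeff x) 3.
  rewrite /series /= !big_nat_recr //= big_geq // /exp_coeff /= !factS fact0.
  by rewrite expr0 expr1; field.
apply: nondecreasing_cvgn_le; last exact: is_cvg_series_exp_coeff.
by apply: nondecreasing_series => n _ _; rewrite /exp_coeff /= divr_ge0 ?exprn_ge0.
Qed.

(** Since (1 - x + x^2/2) (1 + x + x^2/2) = 1 + x^4/4 >= 1, the lower bound for exp x inverts to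
    this upper bound for exp (- x). *)
Lemma expRN_le2 x : 0 <= x -> expR (- x) <= 1 - x + x ^+ 2 / 2.
Proof.
move=> x0; have h := expR_ge2 x0; have e := expRxMexpNx_1 x.
have p := expR_gt0 (- x).
have q : 0 <= 1 - x + x ^+ 2 / 2 by nra.
have k : 1 <= (1 - x + x ^+ 2 / 2) * (1 + x + x ^+ 2 / 2).
  have -> : (1 - x + x ^+ 2 / 2) * (1 + x + x ^+ 2 / 2) =
      1 + (x ^+ 2 / 2) ^+ 2 by field.
  by rewrite lerDl sqr_ge0.
rewrite -[leLHS]mul1r; apply: (le_trans (ler_wpM2r (ltW p) k)).
by rewrite -mulrA ger_pMr ?(lt_le_trans _ k) //; nra.
Qed.

(** This is [expRN_le2] at x = - 2 ln r, where exp (- x) = r^2. *)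
Lemma ln_sqr_ge r : 0 < r -> r <= 1 -> (r ^+ 2 - 1) / 2 - ln r <= ln r ^+ 2.
Proof.
move=> r0 r1; have l0 : ln r <= 0 by exact: ln_le0.
have x0 : 0 <= - (2 * ln r) by lra.
by have := expRN_le2 x0; rewrite opprK expRM_natl lnK ?posrE //; nra.
Qed.

End Inequality.

(** * Both logarithmic measures as sums over the roots *)

Section MahlerFormulas.
Context {R : realType}.
Local Notation mu := (@lebesgue_measure R).
Implicit Types P : {poly R[i]}.

Lemma modulus_horner P (w : R[i]) :
  modulus P.[w] = modulus (lead_coef P) *
    \prod_(z <- roots_with_mult P) modulus (w - z).
Proof.
have {1}-> := svalP (closed_field_poly_normal P).
rewrite hornerZ Normc.normcM horner_prod modulus_prod; congr (_ * _).
by apply: eq_bigr => z _; rewrite hornerXsubC.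
Qed.

Lemma root_roots_with_mult P z : z \in roots_with_mult P -> root P z.
Proof.
move=> zr; apply/rootP/Normc.eq0_normc; rewrite modulus_horner.
by rewrite (big_rem z) //= subrr Normc.normc0 mul0r mulr0.
Qed.

Lemma log_mahlerE P : P != 0 ->
  log_mahler P = ln (modulus (lead_coef P)) +
    (2 * pi)^-1 * \sum_(z <- roots_with_mult P) int_lncis z.
Proof.
move=> P0; have pi2 : 2 * pi != 0 :> R by rewrite mulf_neq0 // gt_eqF // pi_gt0.
have c0 : 0 < modulus (lead_coef P) by rewrite modulus_gt0 lead_coef_eq0.
(* The length is read off by integrating the constant 1 in two ways. *)
have mI : fine (mu `[0, 2 * pi]%classic) = 2 * pi.
  by have := Rintegral_cst_circle (1 : R); rewrite Rintegral_cst // mul1r mulr1.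
rewrite /log_mahler.
under eq_Rintegral do rewrite modulus_horner.
rewrite (@Rintegral_ln_prod R _ _ mu _ _ (measurable_itv _) _
  (fun z t => modulus (cis t - z))) //.
- by rewrite mI mulrDr mulrCA mulVf // mulr1.
- have /= -> := @lebesgue_measure_itv R `[0, 2 * pi]%R.
  by case: ifP => _; rewrite ?ltry.
- by move=> z; apply: continuous_measurable_fun; exact: continuous_modulus_cisB.
- by move=> z t; exact: modulus_ge0.
- by move=> z _; exact: integrable_lncis.
- by move=> z _; exact: negligible_cis_eq.
Qed.

Lemma log_areal_mahlerE P : P.[0] != 0 ->
  log_areal_mahler P = ln (modulus (lead_coef P)) +
    pi^-1 * \sum_(z <- roots_with_mult P) disk_log z.
Proof.
move=> P00; have P0 : P != 0 by apply: contraNneq P00 => ->; rewrite horner0.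
have pi2 : pi != 0 :> R by rewrite gt_eqF // pi_gt0.
have c0 : 0 < modulus (lead_coef P) by rewrite modulus_gt0 lead_coef_eq0.
have z0 z : z \in roots_with_mult P -> z != 0.
  by move=> /root_roots_with_mult; apply: contraTneq => ->; rewrite rootE.
rewrite /log_areal_mahler.
under eq_Rintegral do rewrite modulus_horner.
have mD : measurable (@unit_disk R) := measurable_disk 1.
rewrite (@Rintegral_ln_prod R _ _ (mu \x mu)%E _ _ mD _
  (fun z xy => modulus (Complex xy.1 xy.2 - z))) //.
- rewrite [X in fine X](@disk_area1 R) /= mulrDr mulrCA mulVf // mulr1.
  congr (_ + _ * _); apply: eq_big_seq => z zr.
  by have [_ ->] := disk_log_integral (z0 z zr).
- by rewrite [X in (X < _)%E](@disk_area1 R) ltry.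
- by move=> z; exact: measurable_modulus_sub.
- by move=> z t; exact: modulus_ge0.
- by move=> z zr; have [] := disk_log_integral (z0 z zr).
- move=> z _.
  apply: (@negligibleS _ _ _ (mu \x mu)%E [set xy | rad xy = modulus z]).
    by move=> xy [_ /Normc.eq0_normc/subr0_eq <-].
  by apply/negligibleP; [exact: measurable_circle|exact: circle_null].
Qed.

Lemma sum_count (s : seq R[i]) (p : pred R[i]) (c : R) :
  \sum_(z <- s | p z) c = (count p s)%:R * c.
Proof. by rewrite big_const_seq iter_addr_0 mulr_natl. Qed.

End MahlerFormulas.

(** * The inequality between the two measures *)

Unset Implicit Arguments.

Theorem theorem1p4 (R : realType) (P : {poly R[i]})
    (Pbal : balanced P)
    (P0 : modulus P.[0] = 1)
    (Pareal : areal_mahler P < expR 1)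
    (PZ : (1 <= num_roots_disk P)%N) :
  ln (mahler P) ^+ 2 / (num_roots_disk P)%:R >= ln (areal_mahler P).
Proof.
rewrite /mahler /areal_mahler !expRK.
set r := roots_with_mult P; set Z := (num_roots_disk P)%:R.
have Z0 : 0 < Z :> R by rewrite ltr0n.
have P00 : P.[0] != 0 by rewrite -modulus_gt0 P0.
have Pn0 : P != 0 by apply: contraNneq P00 => ->; rewrite horner0.
have c0 : 0 < modulus (lead_coef P) by rewrite modulus_gt0 lead_coef_eq0.
have rr z : z \in r -> root P z := @root_roots_with_mult R P z.
have z0 z : z \in r -> 0 < modulus z.
  by move=> /rr; rewrite modulus_gt0; apply: contraTneq => ->; rewrite rootE.
(* Evaluating the factorization at 0, where |P(0)| = 1, trades the leading coefficient for the
   roots. *)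
have lc : ln (modulus (lead_coef P)) = \sum_(z <- r) - ln (modulus z).
  have : ln (modulus P.[0]) = 0 by rewrite P0 ln1.
  rewrite modulus_horner -/r.
  have [pp e] : 0 < \prod_(z <- r) modulus (0 - z) /\
      ln (\prod_(z <- r) modulus (0 - z)) = \sum_(z <- r) ln (modulus z).
    elim: r z0 {rr} => [|z s IH] z0; first by rewrite !big_nil ln1.
    have [p0 e] := IH (fun w ws => z0 w (mem_behead (s := z :: s) ws)).
    have zp := z0 z (mem_head _ _).
    by rewrite !big_cons sub0r modulusN mulr_gt0 // lnM // e.
  by rewrite lnM // e sumrN => /eqP; rewrite addr_eq0 => /eqP.
have [w wr w1] : exists2 w, w \in r & modulus w < 1.
  by apply/hasP; rewrite has_count.
set rho := modulus w.
have r0 : 0 < rho := z0 w wr.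
have eqrho z : z \in r -> modulus z < 1 -> modulus z = rho.
  by move=> zr z1; apply: Pbal => //; exact: rr.
(* Balancedness enters here: a sum whose terms vanish at roots outside the open disk collapses to
   [Z] copies of its value at [rho]. *)
have sumE (g : R -> R) (h : R[i] -> R) :
    (forall z, z \in r -> h z = if modulus z < 1 then g (modulus z) else 0) ->
    \sum_(z <- r) h z = Z * g rho.
  move=> hg; rewrite /Z /num_roots_disk -sum_count [RHS]big_mkcond /=.
  apply: eq_big_seq => z zr; rewrite hg //; case: ifP => // z1.
  by rewrite eqrho.
have pi2 : 0 < 2 * pi :> R by rewrite mulr_gt0 // pi_gt0.
(* After [lc], a root contributes at least - ln |z| + ln max(1, |z|), which is 0 when |z| >= 1. The
   inequality comes from roots on the unit circle. *)
have hM : Z * (- ln rho) <= log_mahler P.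
  rewrite log_mahlerE // lc -/r mulr_sumr -big_split /=.
  rewrite -(sumE (fun x => - ln x)
    (fun z => - ln (modulus z) + ln (Num.max 1 (modulus z)))).
    rewrite big_seq [leRHS]big_seq; apply: ler_sum => z zr.
    by rewrite lerD2l ler_pdivlMl // jensen_ge.
  move=> z zr; case: ifPn => [z1|]; first by rewrite (max_idPl (ltW z1)) ln1 addr0.
  by rewrite -leNgt => z1; rewrite (max_idPr z1) addrC subrr.
(* For |z| >= 1 the mean of ln |z' - z| over z' in the disk is ln |z|, which cancels the term from
   [lc]. *)
have hA : log_areal_mahler P = Z * ((rho ^+ 2 - 1) / 2 - ln rho).
  rewrite log_areal_mahlerE // lc -/r mulr_sumr -big_split /=.
  apply: (sumE (fun x => (x ^+ 2 - 1) / 2 - ln x)) => z zr; rewrite /disk_log.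
  have pi0 : pi != 0 :> R by rewrite gt_eqF // pi_gt0.
  by case: ifP => _; rewrite -?mulrA mulKf // addrC ?subrr.
have l0 : ln rho <= 0 by rewrite ln_le0 // ltW.
rewrite hA ler_pdivlMr //.
(* Squaring [hM] is legitimate because its left side is nonnegative; dividing out [Z] twice then
   leaves [ln_sqr_ge] at [rho]. *)
apply: (@le_trans _ _ ((Z * (- ln rho)) ^+ 2)); last first.
  by rewrite ler_sqr ?nnegrE ?(le_trans _ hM) // mulr_ge0 ?oppr_ge0 // ltW.
rewrite exprMn sqrrN expr2 mulrAC -!mulrA ler_pM2l // ler_pM2l //.
by apply: ln_sqr_ge => //; exact: ltW.
Qed.
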